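(* Let $P$ be a poset. If the incomparability graph of $P$ contains finite induced paths of unbounded length, then there is a sequence $(C_n)_{n\in\mathbb{N}}$ of finite paths of unbounded length such that either the direct sum $\bigoplus_n C_n$ or the complete sum $\sum_n C_n$ embeds in the incomparability graph of $P$.
   Context: The incomparability graph $Inc(P)$ of a poset $P=(V,\le)$ has vertex set $V$ and edges the pairs $\{u,v\}$ of distinct incomparable elements. A graph embeds in another if it is isomorphic to an induced subgraph. A path is a graph whose vertices can be injectively mapped into an interval of $\mathbb{Z}$ so that two vertices are adjacent iff their images differ by $1$; its length is the number of vertices minus one. ''Contains finite induced paths of unbounded length'' means: for every $n$ there is an induced subgraph which is a finite path of length at least $n$. For graphs $G_n$ with pairwise disjoint vertex sets, the direct sum $\bigoplus_n G_n$ has vertex set $\bigcup_n V(G_n)$ and edge set $\bigcup_n E(G_n)$; the complete sum $\sum_n G_n$ has the same vertex set and, in addition to $\bigcup_n E(G_n)$, all pairs $\{v,v'\}$ with $v\in V(G_i)$, $v'\in V(G_j)$, $i\ne j$. *)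

(* Defs.v *)
From Stdlib Require Import Arith ZArith List Relations FinFun Eqdep_dec.

Record graph : Type := Graph {
  vertex : Type;
  adj : vertex -> vertex -> Prop;
  adj_irrefl : forall x, ~ adj x x;
  adj_sym : forall x y, adj x y -> adj y x
}.

Arguments adj {g} x y.

Definition isomorphic (G H : graph) : Prop :=
  exists f : vertex G -> vertex H,
    Bijective f /\ forall x y, adj x y <-> adj (f x) (f y).

Definition induced (G : graph) (A : vertex G -> Prop) : graph :=
  Graph {x : vertex G | A x}
    (fun x y => adj (proj1_sig x) (proj1_sig y))
    (fun x => adj_irrefl G (proj1_sig x))
    (fun x y => adj_sym G (proj1_sig x) (proj1_sig y)).

Definition embeds (G H : graph) : Prop :=
  exists A : vertex H -> Prop, isomorphic G (induced H A).

Definition Zinterval (I : Z -> Prop) : Prop :=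
  forall a b c : Z, I a -> I c -> (a <= b <= c)%Z -> I b.

(* The map is onto the interval [I]: if it were only required to be into [I],
   disjoint unions of paths would count as paths. *)
Definition is_path (G : graph) : Prop :=
  exists (I : Z -> Prop) (f : vertex G -> Z),
    Zinterval I /\ Injective f /\
    (forall k, I k <-> exists v, f v = k) /\
    (forall u v, adj u v <-> Z.abs (f u - f v) = 1%Z).

Definition has_order (G : graph) (n : nat) : Prop :=
  exists l : list (vertex G), Listing l /\ length l = n.

Definition finite_path_of_length (G : graph) (n : nat) : Prop :=
  is_path G /\ has_order G (S n).

Definition unbounded_finite_induced_paths (G : graph) : Prop :=
  forall n : nat, exists (A : vertex G -> Prop) (m : nat),
    n <= m /\ finite_path_of_length (induced G A) m.

Definition finite_paths_of_unbounded_length (C : nat -> graph) : Prop :=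
  (forall n, exists m, finite_path_of_length (C n) m) /\
  (forall k, exists n m, k <= m /\ finite_path_of_length (C n) m).

(* The vertex sets of the summands are made disjoint by tagging with the index. *)
Definition sum_vertex (C : nat -> graph) : Type := {n : nat & vertex (C n)}.

Definition summand_adj (C : nat -> graph) (u v : sum_vertex C) : Prop :=
  exists (n : nat) (x y : vertex (C n)),
    u = existT _ n x /\ v = existT _ n y /\ adj x y.

Lemma summand_adj_irrefl C u : ~ summand_adj C u u.
Proof.
  intros (n & x & y & -> & E & H).
  apply inj_pair2_eq_dec in E; [subst y | exact Nat.eq_dec].
  exact (adj_irrefl _ _ H).
Qed.

Lemma summand_adj_sym C u v : summand_adj C u v -> summand_adj C v u.
Proof.
  intros (n & x & y & -> & -> & H).
  exists n, y, x; auto using adj_sym.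
Qed.

Definition direct_sum (C : nat -> graph) : graph :=
  Graph (sum_vertex C) (summand_adj C)
    (summand_adj_irrefl C) (summand_adj_sym C).

Definition complete_adj (C : nat -> graph) (u v : sum_vertex C) : Prop :=
  summand_adj C u v \/ projT1 u <> projT1 v.

Lemma complete_adj_irrefl C u : ~ complete_adj C u u.
Proof.
  intros [H | H]; [exact (summand_adj_irrefl _ _ H) | exact (H eq_refl)].
Qed.

Lemma complete_adj_sym C u v : complete_adj C u v -> complete_adj C v u.
Proof.
  intros [H | H]; [left; exact (summand_adj_sym _ _ _ H) | right; auto].
Qed.

Definition complete_sum (C : nat -> graph) : graph :=
  Graph (sum_vertex C) (complete_adj C)
    (complete_adj_irrefl C) (complete_adj_sym C).

Definition incomparable {V : Type} (le : relation V) (x y : V) : Prop :=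
  ~ (le x y \/ le y x).

Definition inc_adj {V : Type} (le : relation V) (x y : V) : Prop :=
  x <> y /\ incomparable le x y.

Lemma inc_adj_irrefl {V : Type} (le : relation V) x : ~ inc_adj le x x.
Proof. intros [H _]; exact (H eq_refl). Qed.

Lemma inc_adj_sym {V : Type} (le : relation V) x y :
  inc_adj le x y -> inc_adj le y x.
Proof.
  intros [Hne Hinc]; split; [auto | intros [H | H]; apply Hinc; auto].
Qed.

Definition Inc {V : Type} (le : relation V) : graph :=
  Graph V (inc_adj le) (inc_adj_irrefl le) (inc_adj_sym le).

(* Main.v *)
(** Long induced paths of an incomparability graph are, up to reversal, "thick
    chains": the vertex [p i] lies strictly below [p j] as soon as [i + 2 <= j].
    Hence, up to a bounded loss, a single element [y] cuts such a path into an
    initial part below [y], a middle part incomparable to [y] and a final part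
    above [y], so one of the three is long.  Therefore, if a set [X] carries
    arbitrarily long paths (is rich), then so does one of its subsets of elements
    below [y], above [y], or incomparable to [y].  Applying this to all vertices
    of a path of [X], and cutting that path in turn, gives a long path and a rich
    subset of [X] such that every vertex of the path stands in one and the same
    relation to every element of the subset.  Either incomparability can always
    be achieved, and iterating yields a complete sum, or below some rich set only
    comparability occurs, and iterating there yields a direct sum. *)

Require Import Defs.
From Stdlib Require Import Relations Arith ZArith List FinFun Lia.
From Stdlib Require Import Classical ClassicalEpsilon ProofIrrelevance.

(** * The strict order of a poset and its incomparability relation *)

Definition strict {V : Type} (le : relation V) : relation V :=
  fun x y => le x y /\ x <> y.

Lemma strict_trans {V : Type} (le : relation V) (hP : order V le) x y z :
  strict le x y -> strict le y z -> strict le x z.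
Proof.
  destruct hP as [_ htr has]; intros [Hxy Nxy] [Hyz _]; split.
  - exact (htr _ _ _ Hxy Hyz).
  - intros ->; apply Nxy, has; assumption.
Qed.

Lemma strict_irrefl {V : Type} (le : relation V) x : ~ strict le x x.
Proof. intros [_ H]; exact (H eq_refl). Qed.

Lemma inc_adj_not_strict {V : Type} (le : relation V) x y :
  inc_adj le x y -> ~ strict le x y /\ ~ strict le y x.
Proof. intros [_ H]; split; intros [L _]; apply H; auto. Qed.

Lemma inc_adj_of_not_strict {V : Type} (le : relation V) x y :
  x <> y -> ~ strict le x y -> ~ strict le y x -> inc_adj le x y.
Proof.
  intros N H1 H2; split; [exact N |].
  intros [L | L]; [apply H1 | apply H2]; split; auto.
Qed.

(** * Thick chains *)

(** Only the values of [p] below [n] are constrained; since [p] is total, segments are obtained by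
    shifting its argument. *)
Definition thick_chain {V : Type} (le : relation V) (X : V -> Prop)
    (p : nat -> V) (n : nat) : Prop :=
  (forall i, i < n -> X (p i)) /\
  (forall i, S i < n -> inc_adj le (p i) (p (S i))) /\
  (forall i j, i + 2 <= j -> j < n -> strict le (p i) (p j)).

Definition rich {V : Type} (le : relation V) (X : V -> Prop) : Prop :=
  forall n, exists p, thick_chain le X p n.

Lemma thick_chain_restrict {V : Type} (le : relation V) (X Y : V -> Prop) p n a m :
  thick_chain le X p n -> a + m <= n -> (forall i, i < m -> Y (p (a + i))) ->
  thick_chain le Y (fun i => p (a + i)) m.
Proof.
  intros (_ & H1 & H2) Hm HY; split; [exact HY | split].
  - intros i Hi; rewrite Nat.add_succ_r; apply H1; lia.
  - intros i j Hij Hj; apply H2; lia.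
Qed.

Lemma thick_chain_prefix {V : Type} (le : relation V) (X : V -> Prop) p n m :
  thick_chain le X p n -> m <= n -> thick_chain le X p m.
Proof.
  intros H Hm; apply (thick_chain_restrict le X X p n 0 m H Hm).
  intros i Hi; apply H; simpl; lia.
Qed.

Lemma thick_chain_inj {V : Type} (le : relation V) (X : V -> Prop) p n i j :
  thick_chain le X p n -> i < n -> j < n -> p i = p j -> i = j.
Proof.
  intros (_ & H1 & H2).
  assert (K : forall a b, a < b -> b < n -> p a <> p b).
  { intros a b Hab Hb E.
    destruct (Nat.eq_dec b (S a)) as [-> | N].
    - specialize (H1 a Hb); rewrite E in H1; exact (inc_adj_irrefl _ _ H1).
    - assert (S : strict le (p a) (p b)) by (apply H2; lia).
      rewrite E in S; exact (strict_irrefl _ _ S). }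
  intros Hi Hj E; destruct (lt_eq_lt_dec i j) as [[L | ->] | L]; auto.
  - destruct (K i j L Hj E).
  - destruct (K j i L Hi (eq_sym E)).
Qed.

Lemma thick_chain_adj {V : Type} (le : relation V) (X : V -> Prop) p n i j :
  thick_chain le X p n -> i < n -> j < n ->
  inc_adj le (p i) (p j) <-> (j = S i \/ i = S j).
Proof.
  intros (_ & H1 & H2) Hi Hj; split.
  - intros H; apply NNPP; intros N.
    destruct (inc_adj_not_strict _ _ _ H) as [A B].
    destruct (lt_eq_lt_dec i j) as [[L | ->] | L].
    + apply A, H2; lia.
    + exact (inc_adj_irrefl _ _ H).
    + apply B, H2; lia.
  - intros [-> | ->]; [apply H1 | apply inc_adj_sym, H1]; assumption.
Qed.

(** * Induced paths are thick chains *)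

(** If [p i] is below [p j], then [p (S j)] cannot be below [p i]: by transitivity it would be below
    its neighbour [p j]. The same argument at the left end carries the direction from the pair
    [0, 2] to every pair [i, i + 2]. An arbitrary transitive [lt] is allowed so that the reversed
    order is covered too. *)
Lemma path_monotone {V : Type} (lt : relation V) (p : nat -> V) n :
  (forall x y z, lt x y -> lt y z -> lt x z) ->
  (forall i, S i < n -> ~ lt (p i) (p (S i)) /\ ~ lt (p (S i)) (p i)) ->
  (forall i j, i + 2 <= j -> j < n -> lt (p i) (p j) \/ lt (p j) (p i)) ->
  lt (p 0) (p 2) ->
  forall i j, i + 2 <= j -> j < n -> lt (p i) (p j).
Proof.
  intros htr hcons hcomp h02.
  assert (hright : forall i j, i + 2 <= j -> S j < n ->
            lt (p i) (p j) -> lt (p i) (p (S j))).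
  { intros i j Hij Hj L.
    destruct (hcomp i (S j)) as [C | C]; try lia; [exact C |].
    destruct (hcons j Hj) as [_ N]; destruct N; exact (htr _ _ _ C L). }
  assert (hbase : forall i, i + 2 < n -> lt (p i) (p (i + 2))).
  { induction i as [| i IH]; intros Hi; [exact h02 |].
    assert (L : lt (p i) (p (S i + 2))) by (apply (hright i (i + 2)); [lia | lia | apply IH; lia]).
    destruct (hcomp (S i) (S i + 2)) as [C | C]; try lia; [exact C |].
    destruct (hcons i ltac:(lia)) as [N _]; destruct N; exact (htr _ _ _ L C). }
  intros i j Hij; induction Hij as [| j Hij IH]; intros Hj.
  - apply hbase; exact Hj.
  - apply hright; [lia | lia | apply IH; lia].
Qed.

Lemma path_thick_chain {V : Type} (le : relation V) (hP : order V le)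
    (p : nat -> V) n :
  (forall i j, i < n -> j < n -> p i = p j -> i = j) ->
  (forall i j, i < n -> j < n -> inc_adj le (p i) (p j) <-> (j = S i \/ i = S j)) ->
  exists q, thick_chain le (fun _ => True) q n.
Proof.
  intros hinj hadj.
  assert (hcons : forall i, S i < n ->
            ~ strict le (p i) (p (S i)) /\ ~ strict le (p (S i)) (p i)).
  { intros i Hi; apply inc_adj_not_strict, hadj; lia. }
  assert (hcomp : forall i j, i + 2 <= j -> j < n ->
            strict le (p i) (p j) \/ strict le (p j) (p i)).
  { intros i j Hij Hj; apply NNPP; intros N.
    assert (A : inc_adj le (p i) (p j)).
    { apply inc_adj_of_not_strict; [| tauto ..].
      intros E; apply hinj in E; lia. }
    apply hadj in A; lia. }
  destruct (classic (strict le (p 0) (p 2))) as [h02 | h02].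
  - exists p; split; [easy | split].
    + intros i Hi; apply hadj; lia.
    + apply path_monotone; try assumption; exact (strict_trans le hP).
  (* For [n] at least 3, [p 2] is now below [p 0]: the path descends and is read backwards. For
     smaller [n] the order condition is vacuous. *)
  - exists (fun i => p (n - 1 - i)); split; [easy | split].
    + intros i Hi; apply hadj; lia.
    + intros i j Hij Hj.
      apply (path_monotone (fun x y => strict le y x) p n); try lia.
      * intros x y z H1 H2; exact (strict_trans le hP _ _ _ H2 H1).
      * intros k Hk; apply and_comm, hcons; exact Hk.
      * intros a b Hab Hb; apply or_comm, hcomp; assumption.
      * destruct (hcomp 0 2); [lia .. | contradiction | assumption].
Qed.

Lemma list_Z_minimum (l : list Z) :
  l <> nil -> exists a, In a l /\ forall b, In b l -> (a <= b)%Z.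
Proof.
  induction l as [| x l IH]; intros N; [easy |].
  destruct l as [| y l].
  - exists x; split; [now left |]; intros b [-> | []]; lia.
  - destruct IH as (a & Ha & Hmin); [easy |].
    destruct (Z_le_gt_dec x a) as [L | L].
    + exists x; split; [now left |].
      intros b [-> | Hb]; [lia |]; specialize (Hmin b Hb); lia.
    + exists a; split; [now right |].
      intros b [-> | Hb]; [lia |]; exact (Hmin b Hb).
Qed.

Lemma finite_Zinterval_initial (I : Z -> Prop) (l : list Z) :
  Zinterval I -> NoDup l -> (forall k, In k l <-> I k) -> l <> nil ->
  exists a, forall i, i < length l -> I (a + Z.of_nat i)%Z.
Proof.
  intros hI hl hlI hne.
  destruct (list_Z_minimum l hne) as (a & Ha & Hmin).
  exists a; intros i Hi; apply NNPP; intros N.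
  (* All points of [l] would be among the [i] integers from [a] to [a + i - 1]. *)
  assert (Hincl : incl l (map (fun k => (a + Z.of_nat k)%Z) (seq 0 i))).
  { intros b Hb; specialize (Hmin b Hb).
    assert (Hbi : (b < a + Z.of_nat i)%Z).
    { apply Z.nle_gt; intros C; apply N.
      apply (hI a _ b); [now apply hlI .. | lia]. }
    apply in_map_iff; exists (Z.to_nat (b - a)); split; [lia |].
    apply in_seq; lia. }
  apply (NoDup_incl_length hl) in Hincl.
  rewrite length_map, length_seq in Hincl; lia.
Qed.

(** Vertex [i] is the preimage of [a + i], where [a] is the start of a run of [S m] consecutive
    integers in the interval of coordinates. *)
Lemma finite_path_enumeration (G : graph) m :
  finite_path_of_length G m ->
  exists p : nat -> vertex G,
    (forall i j, i < S m -> j < S m -> p i = p j -> i = j) /\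
    (forall i j, i < S m -> j < S m -> adj (p i) (p j) <-> (j = S i \/ i = S j)).
Proof.
  intros [(I & f & hI & hf & hIf & hadj) (l & (hnd & hfull) & hlen)].
  destruct (finite_Zinterval_initial I (map f l)) as [a Ha]; auto.
  - apply Injective_map_NoDup; assumption.
  - intros k; rewrite hIf, in_map_iff; split.
    + intros (v & E & _); eauto.
    + intros (v & E); eauto.
  - destruct l; [discriminate hlen | easy].
  - rewrite length_map, hlen in Ha.
    (* The guard [i < S m] makes this hold for every [i], so that choice gives a total map; past the
       end, the preimage of [a] is the default value. *)
    assert (K : forall i, exists v, i < S m -> f v = (a + Z.of_nat i)%Z).
    { intros i; destruct (lt_dec i (S m)) as [Hi | Hi].
      - destruct (proj1 (hIf _) (Ha i Hi)) as [v Hv]; eauto.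
      - destruct (proj1 (hIf _) (Ha 0 (Nat.lt_0_succ m))) as [v _].
        exists v; intros; contradiction. }
    exists (fun i => proj1_sig (constructive_indefinite_description _ (K i))).
    split; intros i j Hi Hj;
      destruct (constructive_indefinite_description _ (K i)) as [u Hu];
      destruct (constructive_indefinite_description _ (K j)) as [v Hv]; simpl.
    + intros ->; rewrite Hv in Hu by assumption; specialize (Hu Hi); lia.
    + rewrite hadj, Hu, Hv by assumption; lia.
Qed.

Lemma rich_full {V : Type} (le : relation V) (hP : order V le) :
  unbounded_finite_induced_paths (Inc le) -> rich le (fun _ => True).
Proof.
  intros H n; destruct (H n) as (A & m & Hm & Hpath).
  destruct (finite_path_enumeration _ _ Hpath) as (p & hinj & hadj).
  destruct (path_thick_chain le hP (fun i => proj1_sig (p i)) (S m)) as [q Hq].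
  - intros i j Hi Hj E; apply hinj; try assumption.
    apply eq_sig_hprop; [intros; apply proof_irrelevance | exact E].
  - exact hadj.
  - exists q; apply (thick_chain_prefix _ _ _ (S m)); [exact Hq | lia].
Qed.

(** * Homogeneous pairs of a chain and a rich set *)

(** Distinctness is included so that, as with [inc_adj], vertices of different chains never
    coincide. *)
Definition nonadjacent {V : Type} (le : relation V) (x y : V) : Prop :=
  x <> y /\ ~ inc_adj le x y.

Lemma strict_nonadjacent {V : Type} (le : relation V) x y :
  strict le x y \/ strict le y x -> nonadjacent le x y.
Proof.
  intros H; split.
  - intros ->; destruct H as [H | H]; exact (strict_irrefl _ _ H).
  - intros A; apply inc_adj_not_strict in A; tauto.
Qed.

Lemma rich_split {V : Type} (le : relation V) (hP : order V le) X y :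
  rich le X ->
  rich le (fun x => X x /\ strict le x y) \/
  rich le (fun x => X x /\ strict le y x) \/
  rich le (fun x => X x /\ inc_adj le y x).
Proof.
  intros HX; apply NNPP; intros N.
  apply not_or_and in N; destruct N as [N1 N].
  apply not_or_and in N; destruct N as [N2 N3].
  apply not_all_ex_not in N1; destruct N1 as [n1 N1].
  apply not_all_ex_not in N2; destruct N2 as [n2 N2].
  apply not_all_ex_not in N3; destruct N3 as [n3 N3].
  (* No chain of [n1] vertices lies below [y], none of [n2] above, none of [n3] beside it. The extra
     5 pays for the vertices lost near the two cuts. *)
  set (n := n1 + n2 + n3 + 5).
  destruct (HX n) as [p Hp]; pose proof Hp as (HpX & _ & Hlt).
  assert (K1 : forall j, n1 + 1 <= j -> j < n -> ~ strict le (p j) y).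
  { intros j Hj Hjn L; apply N1; exists (fun i => p (0 + i)).
    apply (thick_chain_restrict le X _ p n); [exact Hp | lia |].
    intros i Hi; split; [apply HpX; lia |].
    apply (strict_trans le hP _ (p j)); [apply Hlt; lia | exact L]. }
  assert (K2 : forall j, j + n2 + 2 <= n -> ~ strict le y (p j)).
  { intros j Hj L; apply N2; exists (fun i => p (j + 2 + i)).
    apply (thick_chain_restrict le X _ p n); [exact Hp | lia |].
    intros i Hi; split; [apply HpX; lia |].
    apply (strict_trans le hP _ (p j)); [exact L | apply Hlt; lia]. }
  apply N3; exists (fun i => p (n1 + 1 + i)).
  apply (thick_chain_restrict le X _ p n); [exact Hp | lia |].
  intros i Hi; split; [apply HpX; lia |].
  apply inc_adj_of_not_strict; [| apply K2; lia | apply K1; lia].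
  (* If [y] were this vertex of the chain, the vertex two places further would be above [y], against
     [K2]. *)
  intros ->; apply (K2 (n1 + 1 + i + 2)); [lia |]; apply Hlt; lia.
Qed.

(** Split by [p 0], [p 1], and so on in turn; relations already secured survive passing to a
    subset. *)
Lemma rich_homogeneous {V : Type} (le : relation V) (hP : order V le) X p n :
  rich le X ->
  exists Y, rich le Y /\ (forall x, Y x -> X x) /\
    forall i, i < n ->
      (forall x, Y x -> strict le x (p i)) \/
      (forall x, Y x -> strict le (p i) x) \/
      (forall x, Y x -> inc_adj le (p i) x).
Proof.
  intros HX; induction n as [| n (Y & HY & HYX & Hhom)].
  - exists X; repeat split; auto; intros i Hi; lia.
  - assert (Hstep : forall Q : V -> Prop,
              rich le (fun x => Y x /\ Q x) ->
              (forall Z : V -> Prop, (forall x, Z x -> Q x) ->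
                 (forall x, Z x -> strict le x (p n)) \/
                 (forall x, Z x -> strict le (p n) x) \/
                 (forall x, Z x -> inc_adj le (p n) x)) ->
              exists Z, rich le Z /\ (forall x, Z x -> X x) /\
                forall i, i < S n ->
                  (forall x, Z x -> strict le x (p i)) \/
                  (forall x, Z x -> strict le (p i) x) \/
                  (forall x, Z x -> inc_adj le (p i) x)).
    { intros Q HQ Hn; exists (fun x => Y x /\ Q x); split; [exact HQ |].
      split; [intros x [Hx _]; auto |].
      intros i Hi; destruct (Nat.eq_dec i n) as [-> | Ne].
      - apply Hn; intros x [_ Hx]; exact Hx.
      - destruct (Hhom i ltac:(lia)) as [K | [K | K]];
          [left | right; left | right; right]; intros x [Hx _]; auto. }
    destruct (rich_split le hP Y (p n) HY) as [H | [H | H]];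
      apply (Hstep _ H); auto.
Qed.

Definition homogeneous_step {V : Type} (le R : relation V) (X : V -> Prop)
    (k : nat) (Y : V -> Prop) (q : nat -> V) : Prop :=
  rich le Y /\ (forall x, Y x -> X x) /\ thick_chain le X q k /\
  forall i, i < k -> forall x, Y x -> R (q i) x.

(** Take [3 * k + 2] vertices and make [Y] homogeneous to each. If one of index at least [k + 1] is
    below [Y], so are the first [k]; if one of index at most [2 * k] is above [Y], so are the [k]
    vertices starting two places later. Otherwise the vertices [k + 1] to [2 * k] are all
    incomparable to [Y]. *)
Lemma homogeneous_step_exists {V : Type} (le : relation V) (hP : order V le) X k :
  rich le X ->
  (exists Y q, homogeneous_step le (inc_adj le) X k Y q) \/
  (exists Y q, homogeneous_step le (nonadjacent le) X k Y q).
Proof.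
  intros HX; set (n := 3 * k + 2).
  destruct (HX n) as [p Hp]; pose proof Hp as (HpX & _ & Hlt).
  destruct (rich_homogeneous le hP X p n HX) as (Y & HY & HYX & Hhom).
  destruct (classic (exists j, k + 1 <= j /\ j < n /\
              forall x, Y x -> strict le (p j) x)) as [(j & Hj & Hjn & L) | N1].
  { right; exists Y, p; split; [exact HY | split; [exact HYX | split]].
    - apply (thick_chain_prefix _ _ _ n); [exact Hp | lia].
    - intros i Hi x Hx; apply strict_nonadjacent; left.
      apply (strict_trans le hP _ (p j)); [apply Hlt; lia | auto]. }
  destruct (classic (exists j, j + k + 2 <= n /\
              forall x, Y x -> strict le x (p j))) as [(j & Hj & L) | N2].
  { right; exists Y, (fun i => p (j + 2 + i)).
    split; [exact HY | split; [exact HYX | split]].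
    - apply (thick_chain_restrict le X _ p n); [exact Hp | lia |].
      intros i Hi; apply HpX; lia.
    - intros i Hi x Hx; apply strict_nonadjacent; right.
      apply (strict_trans le hP _ (p j)); [auto | apply Hlt; lia]. }
  left; exists Y, (fun i => p (k + 1 + i)).
  split; [exact HY | split; [exact HYX | split]].
  - apply (thick_chain_restrict le X _ p n); [exact Hp | lia |].
    intros i Hi; apply HpX; lia.
  - intros i Hi; destruct (Hhom (k + 1 + i) ltac:(lia)) as [K | [K | K]].
    + destruct N2; exists (k + 1 + i); split; [lia | exact K].
    + destruct N1; exists (k + 1 + i); split; [lia | split; [lia | exact K]].
    + exact K.
Qed.

(** * Iterating homogeneous steps *)

Lemma homogeneous_step_weaken {V : Type} (le R : relation V)
    (X X' Y : V -> Prop) k k' q :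
  homogeneous_step le R X k Y q -> (forall x, X x -> X' x) -> k' <= k ->
  homogeneous_step le R X' k' Y q.
Proof.
  intros (HY & HYX & (Hq & Hcons & Hlt) & HR) HX Hk.
  split; [exact HY | split; [auto | split]].
  - split; [| split]; [intros i Hi; apply HX, Hq; lia | intros i Hi; apply Hcons; lia |].
    intros i j Hij Hj; apply Hlt; lia.
  - intros i Hi; apply HR; lia.
Qed.

(** By dependent choice: each step takes a chain from the current rich set and leaves a smaller one,
    all of whose elements are in relation [R] to that chain. Every later chain lies in what was
    left. The [n]-th chain has [S n] vertices, hence length [n]. *)
Lemma homogeneous_sequence {V : Type} (le R : relation V) (X0 : V -> Prop) :
  rich le X0 ->
  (forall X k, rich le X -> (forall x, X x -> X0 x) ->
     exists Y q, homogeneous_step le R X k Y q) ->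
  exists q : nat -> nat -> V,
    (forall n, thick_chain le (fun _ => True) (q n) (S n)) /\
    (forall n m i j, n < m -> i < S n -> j < S m -> R (q n i) (q m j)).
Proof.
  intros HX0 Hstep.
  set (S0 := {X : V -> Prop | rich le X /\ forall x, X x -> X0 x}).
  assert (E : forall (s : S0) n, exists r : S0 * (nat -> V),
            homogeneous_step le R (proj1_sig s) (S n) (proj1_sig (fst r)) (snd r)).
  { intros [X [HX HXX0]] n; destruct (Hstep X (S n) HX HXX0) as (Y & q & H).
    assert (HY : rich le Y /\ forall x, Y x -> X0 x)
      by (destruct H as (HY & HYX & _); auto).
    exists (exist _ Y HY, q); exact H. }
  set (next := fun s n => proj1_sig (constructive_indefinite_description _ (E s n))).
  assert (Hnext : forall s n, homogeneous_step le R (proj1_sig s) (S n)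
                    (proj1_sig (fst (next s n))) (snd (next s n)))
    by (intros s n; exact (proj2_sig (constructive_indefinite_description _ (E s n)))).
  set (s0 := exist _ X0 (conj HX0 (fun x H => H)) : S0).
  (* [state n] is the rich set from which the [n]-th chain is taken. *)
  set (state := nat_rect (fun _ => S0) s0 (fun n s => fst (next s n))).
  assert (Hstate : forall n, homogeneous_step le R (proj1_sig (state n)) (S n)
                     (proj1_sig (state (S n))) (snd (next (state n) n)))
    by (intros n; exact (Hnext (state n) n)).
  assert (Hdecr : forall n m, n <= m ->
            forall x, proj1_sig (state m) x -> proj1_sig (state n) x).
  { intros n m Hnm; induction Hnm as [| m _ IH]; intros x Hx; [exact Hx |].
    apply IH, (Hstate m); exact Hx. }
  exists (fun n => snd (next (state n) n)); split.
  - intros n; destruct (Hstate n) as (_ & _ & (_ & H) & _); split; auto.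
  - intros n m i j Hnm Hi Hj.
    destruct (Hstate n) as (_ & _ & _ & HR).
    apply HR; [exact Hi |].
    apply (Hdecr (S n) m); [exact Hnm |].
    apply (Hstate m); exact Hj.
Qed.

(** * Sums of finite paths *)

Definition path_adj (n : nat) (i j : {k : nat | k < S n}) : Prop :=
  proj1_sig j = S (proj1_sig i) \/ proj1_sig i = S (proj1_sig j).

Lemma path_adj_irrefl n i : ~ path_adj n i i.
Proof. unfold path_adj; lia. Qed.

Lemma path_adj_sym n i j : path_adj n i j -> path_adj n j i.
Proof. unfold path_adj; lia. Qed.

Definition path_graph (n : nat) : graph :=
  Graph {k : nat | k < S n} (path_adj n) (path_adj_irrefl n) (path_adj_sym n).

(** Used to turn [seq 0 (S n)] into a listing of the vertices of [path_graph n]. *)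
Lemma list_sig_lift {A : Type} (P : A -> Prop) (l : list A) :
  (forall x, In x l -> P x) -> exists l' : list {x | P x}, map (@proj1_sig _ _) l' = l.
Proof.
  induction l as [| x l IH]; intros H; [now exists nil |].
  destruct IH as [l' <-]; [intros y Hy; apply H; now right |].
  now exists (exist P x (H x (or_introl eq_refl)) :: l').
Qed.

Lemma path_graph_is_path n : finite_path_of_length (path_graph n) n.
Proof.
  assert (hinj : forall u v : {k | k < S n}, proj1_sig u = proj1_sig v -> u = v).
  { intros u v; apply eq_sig_hprop; intros; apply proof_irrelevance. }
  split.
  - exists (fun k => 0 <= k <= Z.of_nat n)%Z, (fun v => Z.of_nat (proj1_sig v)).
    split; [| split; [| split]].
    + intros a b c; lia.
    + intros u v E; apply hinj; lia.
    + intros k; split.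
      * intros Hk; assert (L : Z.to_nat k < S n) by lia.
        exists (exist (fun i => i < S n) _ L); simpl; lia.
      * intros [[v Hv] <-]; simpl; lia.
    + intros [u Hu] [v Hv]; simpl; unfold path_adj; simpl; lia.
  - destruct (list_sig_lift (fun k => k < S n) (seq 0 (S n))) as [l Hl].
    { intros x Hx; apply in_seq in Hx; lia. }
    exists l; split; [split |].
    + apply (NoDup_map_inv (@proj1_sig _ _)); rewrite Hl; apply seq_NoDup.
    + intros v.
      assert (Hv : In (proj1_sig v) (map (@proj1_sig _ _) l)).
      { rewrite Hl; apply in_seq; pose proof (proj2_sig v); simpl in *; lia. }
      apply in_map_iff in Hv; destruct Hv as (w & E & Hw).
      apply hinj in E; subst w; exact Hw.
    + rewrite <- (length_seq (S n) 0), <- Hl; symmetry; apply length_map.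
Qed.

Lemma path_graph_unbounded : finite_paths_of_unbounded_length path_graph.
Proof.
  split; [intros n; exists n | intros k; exists k, k; split; [lia |]];
    apply path_graph_is_path.
Qed.

Lemma embeds_of_injective (G H : graph) (f : vertex G -> vertex H) :
  Injective f -> (forall x y, adj x y <-> adj (f x) (f y)) -> embeds G H.
Proof.
  intros hinj hadj; exists (fun y => exists x, f x = y).
  exists (fun x => exist _ (f x) (ex_intro _ x eq_refl)); split; [| exact hadj].
  (* [Bijective] asks for an inverse function; choice supplies a preimage, unique by injectivity. *)
  exists (fun y : {y | exists x, f x = y} =>
    proj1_sig (constructive_indefinite_description _ (proj2_sig y))).
  split.
  - intros x; simpl.
    destruct (constructive_indefinite_description _ _) as [z Hz]; simpl.
    apply hinj; exact Hz.
  - intros [y Hy]; simpl.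
    destruct (constructive_indefinite_description _ _) as [z Hz]; simpl.
    apply eq_sig_hprop; [intros; apply proof_irrelevance | exact Hz].
Qed.

Lemma summand_adj_same (C : nat -> graph) n (x y : vertex (C n)) :
  summand_adj C (existT _ n x) (existT _ n y) <-> adj x y.
Proof.
  split.
  - intros (m & a & b & E1 & E2 & H).
    pose proof (f_equal (@projT1 _ _) E1) as E; simpl in E; subst m.
    apply Eqdep_dec.inj_pair2_eq_dec in E1, E2; try exact Nat.eq_dec.
    subst; exact H.
  - intros H; exists n, x, y; auto.
Qed.

Lemma summand_adj_index (C : nat -> graph) u v :
  summand_adj C u v -> projT1 u = projT1 v.
Proof. intros (n & x & y & -> & -> & _); reflexivity. Qed.

Definition sum_map {V : Type} (q : nat -> nat -> V) (u : sum_vertex path_graph) : V :=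
  q (projT1 u) (proj1_sig (projT2 u)).

(** The iteration relates earlier chains to later ones only; symmetry of [R] gives the other
    direction. *)
Lemma sum_map_rel {V : Type} (R : relation V) (q : nat -> nat -> V) :
  (forall x y, R x y -> R y x) ->
  (forall n m i j, n < m -> i < S n -> j < S m -> R (q n i) (q m j)) ->
  forall u v, projT1 u <> projT1 v -> R (sum_map q u) (sum_map q v).
Proof.
  intros hsym hR [n [i Hi]] [m [j Hj]] N; unfold sum_map; simpl in *.
  destruct (lt_eq_lt_dec n m) as [[L | L] | L]; [| contradiction |];
    [| apply hsym]; apply hR; assumption.
Qed.

(** Within one summand a thick chain repeats no vertex; across summands [R] forces distinctness. *)
Lemma sum_map_injective {V : Type} (le R : relation V) (q : nat -> nat -> V) :
  (forall n, thick_chain le (fun _ => True) (q n) (S n)) ->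
  (forall x y, R x y -> x <> y) ->
  (forall u v, projT1 u <> projT1 v -> R (sum_map q u) (sum_map q v)) ->
  Injective (sum_map q).
Proof.
  intros hq hne hR u v E.
  destruct (Nat.eq_dec (projT1 u) (projT1 v)) as [En | N];
    [| destruct (hne _ _ (hR u v N) E)].
  destruct u as [n [i Hi]], v as [m [j Hj]]; simpl in En; subst m.
  apply (thick_chain_inj le _ _ _ _ _ (hq n) Hi Hj) in E; subst j.
  rewrite (proof_irrelevance _ Hi Hj); reflexivity.
Qed.

Lemma sum_map_summand_adj {V : Type} (le : relation V) (q : nat -> nat -> V) :
  (forall n, thick_chain le (fun _ => True) (q n) (S n)) ->
  forall u v, projT1 u = projT1 v ->
    summand_adj path_graph u v <-> inc_adj le (sum_map q u) (sum_map q v).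
Proof.
  intros hq [n [i Hi]] [m [j Hj]] E; simpl in E; subst m.
  rewrite summand_adj_same; symmetry.
  exact (thick_chain_adj le _ _ _ _ _ (hq n) Hi Hj).
Qed.

Lemma direct_sum_embeds {V : Type} (le : relation V) (q : nat -> nat -> V) :
  (forall n, thick_chain le (fun _ => True) (q n) (S n)) ->
  (forall n m i j, n < m -> i < S n -> j < S m -> nonadjacent le (q n i) (q m j)) ->
  embeds (direct_sum path_graph) (Inc le).
Proof.
  intros hq hR.
  assert (hR' := sum_map_rel (nonadjacent le) q
    ltac:(intros x y [A B]; split; auto using inc_adj_sym) hR).
  apply (embeds_of_injective (direct_sum path_graph) (Inc le) (sum_map q)).
  - apply (sum_map_injective le (nonadjacent le) q hq); [intros x y []; auto | exact hR'].
  - intros u v; destruct (Nat.eq_dec (projT1 u) (projT1 v)) as [E | N].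
    + exact (sum_map_summand_adj le q hq u v E).
    + split; intros H.
      * destruct (N (summand_adj_index _ _ _ H)).
      * destruct (hR' u v N) as [_ K]; destruct (K H).
Qed.

Lemma complete_sum_embeds {V : Type} (le : relation V) (q : nat -> nat -> V) :
  (forall n, thick_chain le (fun _ => True) (q n) (S n)) ->
  (forall n m i j, n < m -> i < S n -> j < S m -> inc_adj le (q n i) (q m j)) ->
  embeds (complete_sum path_graph) (Inc le).
Proof.
  intros hq hR.
  assert (hR' := sum_map_rel (inc_adj le) q (inc_adj_sym le) hR).
  apply (embeds_of_injective (complete_sum path_graph) (Inc le) (sum_map q)).
  - apply (sum_map_injective le (inc_adj le) q hq); [intros x y []; auto | exact hR'].
  - intros u v; destruct (Nat.eq_dec (projT1 u) (projT1 v)) as [E | N].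
    + rewrite <- (sum_map_summand_adj le q hq u v E : _ <-> @adj (Inc le) _ _).
      split; [intros [H | H]; [exact H | contradiction] | intros H; left; exact H].
    + split; intros _; [exact (hR' u v N) | right; exact N].
Qed.

Theorem theorem2 (V : Type) (le : relation V) (hP : order V le)
  (hpaths : unbounded_finite_induced_paths (Inc le)) :
  exists C : nat -> graph,
    finite_paths_of_unbounded_length C /\
    (embeds (direct_sum C) (Inc le) \/ embeds (complete_sum C) (Inc le)).
Proof.
  exists path_graph; split; [exact path_graph_unbounded |].
  pose proof (rich_full le hP hpaths) as Hrich.
  (* Either incomparability steps are always available, or they fail for some rich [X0] and length
     [k0]. *)
  destruct (classic (forall X k, rich le X ->
              exists Y q, homogeneous_step le (inc_adj le) X k Y q)) as [Hinc | Hinc].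
  - right.
    destruct (homogeneous_sequence le (inc_adj le) (fun _ => True) Hrich)
      as (q & hq & hR); [auto |].
    exact (complete_sum_embeds le q hq hR).
  - left.
    apply not_all_ex_not in Hinc; destruct Hinc as [X0 Hinc].
    apply not_all_ex_not in Hinc; destruct Hinc as [k0 Hinc].
    apply imply_to_and in Hinc; destruct Hinc as [HX0 Hinc].
    destruct (homogeneous_sequence le (nonadjacent le) X0 HX0) as (q & hq & hR).
    + intros X k HX HXX0.
      (* Length [k0 + k] serves both outcomes: an incomparability step in [X] would weaken to one
         for [X0] and [k0], which was excluded, while a nonadjacent step weakens to the required
         length [k]. *)
      destruct (homogeneous_step_exists le hP X (k0 + k) HX)
        as [(Y & q & H) | (Y & q & H)].
      * destruct Hinc; exists Y, q.
        apply (homogeneous_step_weaken _ _ X _ _ (k0 + k)); [exact H | exact HXX0 | lia].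
      * exists Y, q.
        apply (homogeneous_step_weaken _ _ X _ _ (k0 + k)); [exact H | auto | lia].
    + exact (direct_sum_embeds le q hq hR).
Qed.
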